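(* Let $X$ be a topological space and $Y$ be a metrizable, connected and locally arcwise connected space. Then $\mathrm{K}_1(X,Y)\cap\Sigma^f(X,Y)=\mathrm{B}_1(X,Y)$.
   Context: Functionally closed/open sets: zero sets of continuous functions $X\to[0,1]$, resp. their complements; functionally $F_\sigma$: countable union of functionally closed sets. $\mathrm{K}_1(X,Y)$: mappings $f:X\to Y$ with $f^{-1}(V)$ functionally $F_\sigma$ for every open $V\subseteq Y$. A family $(A_i:i\in I)$ of subsets of $X$ is strongly functionally discrete (sfd) if there is a discrete family $(U_i:i\in I)$ of functionally open sets with $\overline{A_i}\subseteq U_i$ for all $i$; $\sigma$-sfd means a countable union of sfd families. A family $\mathcal B$ is a base for $f$ if each $f^{-1}(V)$, $V\subseteq Y$ open, is a union of members of $\mathcal B$. $\Sigma^f(X,Y)$: mappings $X\to Y$ having a $\sigma$-sfd base. $\mathrm{B}_1(X,Y)$: pointwise limits of sequences of continuous mappings $X\to Y$. *)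

(* Defs.v *)
From Stdlib Require Import Reals.
Open Scope R_scope.

Record TopSpace := {
  carrier :> Type;
  is_open : (carrier -> Prop) -> Prop;
  open_full : is_open (fun _ => True);
  open_inter : forall U V, is_open U -> is_open V -> is_open (fun x => U x /\ V x);
  open_union : forall F : (carrier -> Prop) -> Prop,
      (forall U, F U -> is_open U) -> is_open (fun x => exists U, F U /\ U x)
}.
Arguments is_open {t} _.

Definition is_metric {T : Type} (d : T -> T -> R) : Prop :=
  (forall x y, 0 <= d x y) /\
  (forall x y, d x y = 0 <-> x = y) /\
  (forall x y, d x y = d y x) /\
  (forall x y z, d x z <= d x y + d y z).

Definition metric_open {T : Type} (d : T -> T -> R) (U : T -> Prop) : Prop :=
  forall x, U x -> exists eps, 0 < eps /\ forall y, d x y < eps -> U y.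

Definition metrizable (Y : TopSpace) : Prop :=
  exists d : Y -> Y -> R, is_metric d /\ forall U, is_open U <-> metric_open d U.

Definition R_open (W : R -> Prop) : Prop := metric_open (fun s t => Rabs (s - t)) W.

Definition continuous {X Y : TopSpace} (f : X -> Y) : Prop :=
  forall V : Y -> Prop, is_open V -> is_open (fun x => V (f x)).

Definition continuous_to_R {X : TopSpace} (f : X -> R) : Prop :=
  forall W : R -> Prop, R_open W -> is_open (fun x => W (f x)).

Definition connected (Y : TopSpace) : Prop :=
  ~ exists U V : Y -> Prop, is_open U /\ is_open V /\
      (exists y, U y) /\ (exists y, V y) /\
      (forall y, U y \/ V y) /\ (forall y, ~ (U y /\ V y)).

Definition unit_I (t : R) : Prop := 0 <= t <= 1.

(** [g] restricted to [0,1] is an arc: a homeomorphic embedding of [0,1]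
    (with its subspace topology from R) into Y. *)
Definition is_arc {Y : TopSpace} (g : R -> Y) : Prop :=
  (forall V : Y -> Prop, is_open V ->
     exists W, R_open W /\ forall t, unit_I t -> (V (g t) <-> W t)) /\
  (forall s t, unit_I s -> unit_I t -> g s = g t -> s = t) /\
  (forall W, R_open W ->
     exists V : Y -> Prop, is_open V /\ forall t, unit_I t -> (W t <-> V (g t))).

Definition arcwise_connected {Y : TopSpace} (A : Y -> Prop) : Prop :=
  forall x y, A x -> A y -> x <> y ->
    exists g : R -> Y, is_arc g /\ g 0 = x /\ g 1 = y /\
      forall t, unit_I t -> A (g t).

Definition locally_arcwise_connected (Y : TopSpace) : Prop :=
  forall (y : Y) (U : Y -> Prop), is_open U -> U y ->
    exists V, is_open V /\ V y /\ (forall z, V z -> U z) /\ arcwise_connected V.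

Definition functionally_closed {X : TopSpace} (A : X -> Prop) : Prop :=
  exists f : X -> R, continuous_to_R f /\ (forall x, 0 <= f x <= 1) /\
    forall x, A x <-> f x = 0.

Definition functionally_open {X : TopSpace} (A : X -> Prop) : Prop :=
  functionally_closed (fun x => ~ A x).

Definition functionally_Fsigma {X : TopSpace} (A : X -> Prop) : Prop :=
  exists An : nat -> X -> Prop, (forall n, functionally_closed (An n)) /\
    forall x, A x <-> exists n, An n x.

Definition K1 {X Y : TopSpace} (f : X -> Y) : Prop :=
  forall V : Y -> Prop, is_open V -> functionally_Fsigma (fun x => V (f x)).

Definition closure {X : TopSpace} (A : X -> Prop) : X -> Prop :=
  fun x => forall W, is_open W -> W x -> exists z, W z /\ A z.

Definition discrete_family {X : TopSpace} {I : Type} (U : I -> X -> Prop) : Prop :=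
  forall x : X, exists W, is_open W /\ W x /\
    forall i j, (exists z, W z /\ U i z) -> (exists z, W z /\ U j z) -> i = j.

Definition sfd {X : TopSpace} {I : Type} (A : I -> X -> Prop) : Prop :=
  exists U : I -> X -> Prop, (forall i, functionally_open (U i)) /\
    discrete_family U /\ forall i x, closure (A i) x -> U i x.

Definition base_for {X Y : TopSpace} {I : Type} (B : I -> X -> Prop) (f : X -> Y) : Prop :=
  forall V : Y -> Prop, is_open V ->
    forall x, V (f x) <-> exists i, B i x /\ forall z, B i z -> V (f z).

Definition Sigma_f {X Y : TopSpace} (f : X -> Y) : Prop :=
  exists (I : nat -> Type) (B : forall n, I n -> X -> Prop),
    (forall n, sfd (B n)) /\ base_for (fun p : {n : nat & I n} => B (projT1 p) (projT2 p)) f.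

Definition converges {Y : TopSpace} (u : nat -> Y) (y : Y) : Prop :=
  forall V : Y -> Prop, is_open V -> V y -> exists N, forall n, (N <= n)%nat -> V (u n).

Definition Baire1 {X Y : TopSpace} (f : X -> Y) : Prop :=
  exists fn : nat -> X -> Y, (forall n, continuous (fn n)) /\
    forall x, converges (fun n => fn n x) (f x).

(* Main.v *)
Require Import Defs.
From Stdlib Require Import Reals Lra Lia Arith Cantor.
From Stdlib Require Import Classical ClassicalEpsilon FunctionalExtensionality PropExtensionality.
From mathcomp Require ssrbool boolp wochoice.

(** For the inclusion of B_1, let f be the limit of f_n. If V is open, f^{-1}(V) is the union over k, m
    of the intersections over l >= m of f_l^{-1}{dist(., complement of V) >= 1/k}; pulling Stone's
    sigma-discrete covers of Y back along the f_n in the same way gives a sigma-sfd base.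

    For the converse, K_1 and a sigma-sfd base give, for each k, countably many discrete families of
    functionally closed sets covering X, each member labelled by an arcwise connected open region of
    diameter at most 2^{-k} that contains its image under f. At stage N finitely many of these families are
    made disjoint, which gives a continuous weight and a label that is locally constant where the weight
    is positive. Start from a constant map and treat k = 0, 1, ... , N-1 in turn: near the places where the
    weights of all levels up to k are 1, slide the current value along a path inside the region of
    level k-1 to a point of the region of level k. Once the first j labels at x are correct, all later moves at x
    add up to O(2^{-j}), so the resulting maps converge pointwise to f. *)

Lemma pred_ext {T : Type} (U V : T -> Prop) : (forall x, U x <-> V x) -> U = V.
Proof.
  intros H; apply functional_extensionality; intros x.
  apply propositional_extensionality, H.
Qed.

(** * Well-orderings *)

Section WellOrder.
Import boolp.

(** Least elements and comparability of distinct points are what Stone's construction takes from a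
    well-ordering. The strict relation is the negation of the reversed boolean well-order [r]. *)
Lemma strict_well_order (T : Type) :
  exists lt : T -> T -> Prop,
    (forall P : T -> Prop, (exists x, P x) ->
       exists x, P x /\ forall y, lt y x -> ~ P y) /\
    (forall x y, x <> y -> lt x y \/ lt y x).
Proof.
  destruct (wochoice.well_ordering_principle _ :
    {r : ssrbool.rel (boolp.classicType T) | wochoice.well_order r}) as [r Hr].
  assert (Hmin : forall P : T -> Prop, (exists x, P x) ->
            exists x, P x /\ forall y, P y -> is_true (r x y)).
  { intros P [x Px].
    destruct (Hr (fun y => asbool (P y))) as [z [[Pz Hz] _]].
    - exists x. apply asboolT. exact Px.
    - exists z; split.
      + exact (asboolW Pz).
      + intros y Py. apply Hz. apply asboolT. exact Py. }
  exists (fun x y => ~ is_true (r y x)); split.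
  - intros P HP. destruct (Hmin P HP) as [x [Px Hx]].
    exists x; split; [exact Px|]. intros y Hy Py. exact (Hy (Hx y Py)).
  - intros x y Hxy. apply NNPP. intros H. apply Hxy.
    assert (Hyx : is_true (r y x)) by (apply NNPP; tauto).
    assert (Hxy' : is_true (r x y)) by (apply NNPP; tauto).
    (* If [x] and [y] precede each other, both are least in the pair, and least elements are
       unique. *)
    destruct (Hr (fun z => asbool (z = x \/ z = y))) as [z [_ Uz]].
    { exists x. apply asboolT. auto. }
    assert (refl : forall t, is_true (r t t)).
    { intros t. destruct (Hmin (eq t) (ex_intro _ t eq_refl)) as [t' [<- Ht]]. auto. }
    transitivity z; [symmetry|]; apply Uz; split; try (apply asboolT; auto);
      intros t Ht; destruct (asboolW Ht) as [-> | ->]; auto.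
Qed.

End WellOrder.

(** * Neighbourhoods, continuous real functions, functionally closed sets *)

Section Topology.
Context {X : TopSpace}.

Lemma open_iff (U V : X -> Prop) : (forall x, U x <-> V x) -> is_open U -> is_open V.
Proof. intros H. rewrite (pred_ext _ _ H). auto. Qed.

Lemma open_of_nbhds (U : X -> Prop) :
  (forall x, U x -> exists W, is_open W /\ W x /\ forall z, W z -> U z) -> is_open U.
Proof.
  intros H.
  apply open_iff with (fun x => exists W, (is_open W /\ forall z, W z -> U z) /\ W x).
  - intros x; split.
    + intros [W [[_ HW] Wx]]; auto.
    + intros Ux; destruct (H x Ux) as [W [oW [Wx HW]]]; exists W; auto.
  - apply (open_union X). intros W [oW _]; exact oW.
Qed.

Lemma open_prop (P : Prop) : @is_open X (fun _ => P).
Proof.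
  apply open_of_nbhds. intros x p. exists (fun _ => True).
  split; [apply open_full|]; auto.
Qed.

Definition locally (x : X) (P : X -> Prop) : Prop :=
  exists W, is_open W /\ W x /\ forall z, W z -> P z.

Lemma locally_open (U : X -> Prop) x : is_open U -> U x -> locally x U.
Proof. intros oU Ux; exists U; auto. Qed.

Lemma locally_and x (P Q : X -> Prop) :
  locally x P -> locally x Q -> locally x (fun z => P z /\ Q z).
Proof.
  intros [W [oW [Wx HW]]] [W' [oW' [Wx' HW']]].
  exists (fun z => W z /\ W' z). split; [apply open_inter; auto|].
  split; [auto|]. intros z [h h']; auto.
Qed.

Lemma locally_imp x (P Q : X -> Prop) :
  (forall z, P z -> Q z) -> locally x P -> locally x Q.
Proof. intros H [W [oW [Wx HW]]]. exists W; auto. Qed.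

Lemma locally_true x : locally x (fun _ => True).
Proof. apply locally_open; [apply open_full|exact I]. Qed.

Lemma locally_self x (P : X -> Prop) : locally x P -> P x.
Proof. intros [W [_ [Wx H]]]; auto. Qed.

Lemma locally_forall_lt x (P : nat -> X -> Prop) n :
  (forall k, (k < n)%nat -> locally x (P k)) ->
  locally x (fun z => forall k, (k < n)%nat -> P k z).
Proof.
  induction n as [|n IH]; intros H.
  - apply locally_imp with (2 := locally_true x). intros; lia.
  - apply locally_imp with (2 := locally_and _ _ _ (IH (fun k hk => H k ltac:(lia))) (H n ltac:(lia))).
    intros z [h h'] k hk. destruct (Nat.eq_dec k n) as [->|]; auto. apply h; lia.
Qed.

Lemma open_locally (U : X -> Prop) : is_open U <-> forall x, U x -> locally x U.
Proof. split; [intros; apply locally_open; auto | apply open_of_nbhds]. Qed.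

Lemma continuous_R_locally (f : X -> R) :
  continuous_to_R f <->
  forall x eps, 0 < eps -> locally x (fun z => Rabs (f z - f x) < eps).
Proof.
  split.
  - intros Hf x e He.
    apply (locally_open (fun z => Rabs (f z - f x) < e)).
    + apply (Hf (fun t => Rabs (t - f x) < e)). intros t Ht.
      exists (e - Rabs (t - f x)). split; [lra|]. intros s Hs.
      replace (s - f x) with ((t - f x) - (t - s)) by ring.
      unfold Rminus at 1.
      pose proof (Rabs_triang (t - f x) (- (t - s))). rewrite Rabs_Ropp in H. lra.
    + replace (f x - f x) with 0 by ring. rewrite Rabs_R0; exact He.
  - intros Hf W HW. apply open_locally. intros x Wx.
    destruct (HW _ Wx) as [e [He H]].
    apply locally_imp with (2 := Hf x e He). intros z Hz. apply H.
    rewrite Rabs_minus_sym; exact Hz.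
Qed.

Lemma continuous_R_const c : continuous_to_R (fun _ : X => c).
Proof. intros W _. apply open_prop. Qed.

(** One Lipschitz estimate gives continuity of affine images, minima and maxima alike. *)
Lemma continuous_R_lipschitz2 (f g h : X -> R) K :
  (forall x y, Rabs (h x - h y) <= K * (Rabs (f x - f y) + Rabs (g x - g y))) ->
  continuous_to_R f -> continuous_to_R g -> continuous_to_R h.
Proof.
  rewrite !continuous_R_locally. intros H Hf Hg x e He.
  assert (HK : 0 < 2 * (Rabs K + 1)) by (pose proof (Rabs_pos K); lra).
  assert (Hd : 0 < e / (2 * (Rabs K + 1))) by (apply Rdiv_lt_0_compat; lra).
  apply locally_imp with (2 := locally_and _ _ _ (Hf x _ Hd) (Hg x _ Hd)).
  intros z [h1 h2]. eapply Rle_lt_trans; [apply H|].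
  set (a := Rabs (f z - f x) + Rabs (g z - g x)) in *.
  set (d := e / (2 * (Rabs K + 1))) in *.
  assert (Ha : 0 <= a) by (unfold a; pose proof (Rabs_pos (f z - f x)); pose proof (Rabs_pos (g z - g x)); lra).
  assert (Had : a < 2 * d) by (unfold a; lra).
  assert (Hed : e = (Rabs K + 1) * (2 * d)) by (unfold d; field; lra).
  pose proof (RRle_abs K). pose proof (Rabs_pos K). nra.
Qed.

Lemma continuous_R_affine (f : X -> R) a b :
  continuous_to_R f -> continuous_to_R (fun x => a * f x + b).
Proof.
  intros Hf. apply continuous_R_lipschitz2 with (f := f) (g := f) (K := Rabs a); auto.
  intros x y. replace (a * f x + b - (a * f y + b)) with (a * (f x - f y)) by ring.
  rewrite Rabs_mult. pose proof (Rabs_pos a). pose proof (Rabs_pos (f x - f y)). nra.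
Qed.

Lemma continuous_R_min (f g : X -> R) :
  continuous_to_R f -> continuous_to_R g -> continuous_to_R (fun x => Rmin (f x) (g x)).
Proof.
  apply continuous_R_lipschitz2 with (K := 1). intros x y.
  unfold Rmin; do 2 destruct Rle_dec; unfold Rabs; repeat destruct Rcase_abs; lra.
Qed.

Lemma continuous_R_max (f g : X -> R) :
  continuous_to_R f -> continuous_to_R g -> continuous_to_R (fun x => Rmax (f x) (g x)).
Proof.
  apply continuous_R_lipschitz2 with (K := 1). intros x y.
  unfold Rmax; do 2 destruct Rle_dec; unfold Rabs; repeat destruct Rcase_abs; lra.
Qed.

Lemma continuous_R_gt (f : X -> R) c x :
  continuous_to_R f -> c < f x -> locally x (fun z => c < f z).
Proof.
  intros Hf H. rewrite continuous_R_locally in Hf.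
  apply locally_imp with (2 := Hf x (f x - c) ltac:(lra)).
  intros z Hz. apply Rabs_def2 in Hz. lra.
Qed.

Lemma continuous_R_lt (f : X -> R) c x :
  continuous_to_R f -> f x < c -> locally x (fun z => f z < c).
Proof.
  intros Hf H. rewrite continuous_R_locally in Hf.
  apply locally_imp with (2 := Hf x (c - f x) ltac:(lra)).
  intros z Hz. apply Rabs_def2 in Hz. lra.
Qed.

Lemma continuous_R_local_eq (f : X -> R) :
  (forall x, exists g, continuous_to_R g /\ locally x (fun z => f z = g z)) ->
  continuous_to_R f.
Proof.
  intros H. apply continuous_R_locally. intros x e He.
  destruct (H x) as [g [Hg Hx]].
  pose proof (locally_self _ _ Hx) as E.
  rewrite continuous_R_locally in Hg.
  apply locally_imp with (2 := locally_and _ _ _ Hx (Hg x e He)).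
  intros z [E' h]. rewrite E, E'. exact h.
Qed.

Lemma continuous_local_eq {Y : TopSpace} (f : X -> Y) :
  (forall x, exists g : X -> Y, continuous g /\ locally x (fun z => f z = g z)) ->
  continuous f.
Proof.
  intros H V oV. apply open_locally. intros x Vx.
  destruct (H x) as [g [Hg Hx]].
  pose proof (locally_self _ _ Hx) as E. simpl in E. rewrite E in Vx.
  apply locally_imp with (2 := locally_and _ _ _ Hx (locally_open _ x (Hg V oV) Vx)).
  intros z [E' h]. rewrite E'. exact h.
Qed.

Lemma functionally_closed_iff (A B : X -> Prop) :
  (forall x, A x <-> B x) -> functionally_closed A -> functionally_closed B.
Proof. intros H; rewrite (pred_ext _ _ H); auto. Qed.

(** Truncating [f - c] to [0,1] gives a function that vanishes exactly where [f <= c]. *)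
Lemma functionally_closed_le (f : X -> R) c :
  continuous_to_R f -> functionally_closed (fun x => f x <= c).
Proof.
  intros Hf. exists (fun x => Rmin 1 (Rmax 0 (1 * f x + - c))). split; [|split].
  - apply continuous_R_min; [apply continuous_R_const|].
    apply continuous_R_max; [apply continuous_R_const|].
    apply continuous_R_affine; exact Hf.
  - intros x; unfold Rmin, Rmax; repeat destruct Rle_dec; lra.
  - intros x; unfold Rmin, Rmax; repeat destruct Rle_dec; lra.
Qed.

Lemma functionally_open_lt (f : X -> R) c :
  continuous_to_R f -> functionally_open (fun x => f x < c).
Proof.
  intros Hf. unfold functionally_open.
  apply functionally_closed_iff with (fun x => -1 * f x + 0 <= - c).
  - intros x; split; lra.
  - apply functionally_closed_le, continuous_R_affine, Hf.
Qed.

End Topology.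
Lemma functionally_closed_countable_inter {X : TopSpace} (A : nat -> X -> Prop) :
  (forall n, functionally_closed (A n)) -> functionally_closed (fun x => forall n, A n x).
Proof.
  intros HA. apply choice in HA. destruct HA as [a Ha].
  pose (S := fun x r => exists n, r = Rmin (a n x) (/ INR (n + 1))).
  assert (Hpos : forall n, 0 < / INR (n + 1)).
  { intros n. apply Rinv_0_lt_compat, lt_0_INR. lia. }
  assert (Hrange : forall n x, 0 <= a n x <= 1) by (intros n; apply (Ha n)).
  (* The caps [1/(n+1)] make the supremum depend, up to any error, on finitely many [n]. *)
  assert (HS : forall x, exists s, is_lub (S x) s).
  { intros x. destruct (completeness (S x)) as [s Hs].
    - exists 1. intros r [n ->]. specialize (Hrange n x).
      unfold Rmin; destruct Rle_dec; lra.
    - exists (Rmin (a 0%nat x) (/ INR (0 + 1))), 0%nat. reflexivity.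
    - exists s; exact Hs. }
  apply choice in HS. destruct HS as [s Hs].
  assert (Hub : forall n x, Rmin (a n x) (/ INR (n + 1)) <= s x).
  { intros n x. apply (Hs x). exists n; reflexivity. }
  assert (Hle : forall x b, (forall n, Rmin (a n x) (/ INR (n + 1)) <= b) -> s x <= b).
  { intros x b H. apply (Hs x). intros r [n ->]. apply H. }
  assert (Hcont : continuous_to_R s).
  { apply continuous_R_locally. intros x e He.
    destruct (archimed_cor1 (e / 2) ltac:(lra)) as [N [HN HN0]].
    assert (Hn : locally x (fun z => forall n, (n < N)%nat -> Rabs (a n z - a n x) < e / 2)).
    { apply locally_forall_lt. intros n _.
      destruct (Ha n) as [Hc _]. rewrite continuous_R_locally in Hc. apply Hc; lra. }
    apply locally_imp with (2 := Hn). intros z Hz.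
    (* A one-sided estimate, applied in both directions: the neighbourhood controls the indices
       below [N], and the caps are below [e / 2] from [N] on. *)
    assert (Hsym : forall u v, (forall n, (n < N)%nat -> a n v <= a n u + e / 2) ->
                               s v <= s u + e / 2).
    { intros u v Huv. apply Hle. intros n. destruct (Nat.lt_ge_cases n N) as [h|h].
      - specialize (Hub n u). specialize (Huv n h).
        unfold Rmin in *; repeat destruct Rle_dec; lra.
      - assert (/ INR (n + 1) <= / INR N).
        { apply Rinv_le_contravar; [apply lt_0_INR; lia|apply le_INR; lia]. }
        assert (0 <= s u).
        { eapply Rle_trans; [|apply (Hub n u)]. specialize (Hrange n u). specialize (Hpos n).
          unfold Rmin; destruct Rle_dec; lra. }
        pose proof (Rmin_r (a n v) (/ INR (n + 1))). lra. }
    assert (s z <= s x + e / 2).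
    { apply Hsym. intros n h. specialize (Hz n h). apply Rabs_def2 in Hz. lra. }
    assert (s x <= s z + e / 2).
    { apply Hsym. intros n h. specialize (Hz n h). apply Rabs_def2 in Hz. lra. }
    apply Rabs_def1; lra. }
  apply functionally_closed_iff with (2 := functionally_closed_le s 0 Hcont).
  intros x; split.
  - intros Hx n. apply (Ha n). specialize (Hub n x). specialize (Hrange n x).
    specialize (Hpos n). unfold Rmin in Hub; destruct Rle_dec; lra.
  - intros Hx. apply Hle. intros n. rewrite (proj1 (proj2 (proj2 (Ha n)) x) (Hx n)).
    specialize (Hpos n). unfold Rmin; destruct Rle_dec; lra.
Qed.

Lemma functionally_Fsigma_iff {X : TopSpace} (A B : X -> Prop) :
  (forall x, A x <-> B x) -> functionally_Fsigma A -> functionally_Fsigma B.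
Proof. intros H; rewrite (pred_ext _ _ H); auto. Qed.

Lemma functionally_Fsigma_union2 {X : TopSpace} (A : nat -> nat -> X -> Prop) :
  (forall n m, functionally_closed (A n m)) ->
  functionally_Fsigma (fun x => exists n m, A n m x).
Proof.
  intros HA. exists (fun p => A (fst (of_nat p)) (snd (of_nat p))).
  split; [auto|]. intros x; split.
  - intros [n [m H]]. exists (to_nat (n, m)). rewrite cancel_of_to. exact H.
  - intros [p H]. eauto.
Qed.

(** * Limits of continuous maps into a metric space *)

Section Metric.
Context {Y : TopSpace} (d : Y -> Y -> R).
Hypothesis d_metric : is_metric d.
Hypothesis d_topology : forall U : Y -> Prop, is_open U <-> metric_open d U.

Let d_ge0 : forall x y, 0 <= d x y := proj1 d_metric.
Let d_refl : forall x, d x x = 0 :=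
  fun x => proj2 (proj1 (proj2 d_metric) x x) eq_refl.
Let d_sym : forall x y, d x y = d y x := proj1 (proj2 (proj2 d_metric)).
Let d_tri : forall x y z, d x z <= d x y + d y z := proj2 (proj2 (proj2 d_metric)).

Lemma open_ball y r : is_open (fun z => d y z < r).
Proof.
  apply d_topology. intros z Hz. exists (r - d y z). split; [lra|].
  intros w Hw. pose proof (d_tri y z w). lra.
Qed.

Lemma locally_ball {X : TopSpace} (g : X -> Y) x r :
  continuous g -> 0 < r -> locally x (fun z => d (g x) (g z) < r).
Proof.
  intros Hg Hr. apply (locally_open (fun z => d (g x) (g z) < r)).
  - apply (Hg (fun y => d (g x) y < r)), open_ball.
  - rewrite d_refl; exact Hr.
Qed.

Lemma converges_metric u y :
  converges u y <-> forall e, 0 < e -> exists N, forall n, (N <= n)%nat -> d (u n) y < e.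
Proof.
  split.
  - intros H e He. destruct (H _ (open_ball y e)) as [N HN].
    { rewrite d_refl; exact He. }
    exists N. intros n Hn. rewrite d_sym. auto.
  - intros H V oV Vy. apply d_topology in oV. destruct (oV y Vy) as [e [He HV]].
    destruct (H e He) as [N HN]. exists N. intros n Hn. apply HV. rewrite d_sym; auto.
Qed.

(* The distance to [A] truncated at [1], so that it is also defined for empty [A]. *)
Definition is_dist (A : Y -> Prop) (p : Y -> R) : Prop :=
  (forall y, 0 <= p y) /\
  (forall y z, A z -> p y <= d y z) /\
  (forall y r, r <= 1 -> p y < r -> exists e, A e /\ d y e < r) /\
  (forall x y, p x <= p y + d x y).

(** The truncated distance is the supremum of those lower bounds of the distances to [A] that are at
    most 1. They form a nonempty bounded set even if [A] is empty. *)
Lemma dist_exists A : exists p, is_dist A p.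
Proof.
  pose (S := fun y r => r <= 1 /\ forall z, A z -> r <= d y z).
  assert (HS : forall y, exists s, is_lub (S y) s).
  { intros y. destruct (completeness (S y)) as [s Hs].
    - exists 1. intros r [h _]; exact h.
    - exists 0. split; [lra|auto].
    - exists s; exact Hs. }
  apply choice in HS. destruct HS as [p Hp]. exists p.
  assert (Hmax : forall y r, S y r -> r <= p y) by (intros y r h; apply (Hp y), h).
  split; [|split; [|split]].
  - intros y. apply Hmax. split; [lra|auto].
  - intros y z Az. apply (Hp y). intros r [_ h]; auto.
  - intros y r Hr Hlt. apply NNPP. intros Hno.
    enough (r <= p y) by lra. apply Hmax. split; [exact Hr|].
    intros z Az. apply Rnot_lt_le. intros h. apply Hno. eauto.
  - intros x y. apply (Hp x). intros r [h1 h2].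
    enough (r - d x y <= p y) by lra. apply Hmax. split; [pose proof (d_ge0 x y); lra|].
    intros z Az. pose proof (d_tri x y z). pose proof (h2 z Az). lra.
Qed.

Lemma dist_continuous {X : TopSpace} A p (g : X -> Y) :
  is_dist A p -> continuous g -> continuous_to_R (fun x => p (g x)).
Proof.
  intros [_ [_ [_ Hp]]] Hg. apply continuous_R_locally. intros x e He.
  apply locally_imp with (2 := locally_ball g x e Hg He). intros z Hz.
  pose proof (Hp (g x) (g z)). pose proof (Hp (g z) (g x)).
  rewrite (d_sym (g z)) in *. apply Rabs_def1; lra.
Qed.

Lemma Baire1_K1 {X : TopSpace} (f : X -> Y) : Baire1 f -> K1 f.
Proof.
  intros [fn [Hc Hlim]] V oV.
  destruct (dist_exists (fun y => ~ V y)) as [p Hp].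
  apply functionally_Fsigma_iff with
    (fun x => exists k m, forall l, / INR (k + 1) <= p (fn (m + l)%nat x)).
  2: { apply functionally_Fsigma_union2. intros k m.
       apply functionally_closed_countable_inter. intros l.
       apply functionally_closed_iff with (fun x => -1 * p (fn (m + l)%nat x) + 0 <= - / INR (k + 1)).
       - intros x; split; lra.
       - apply functionally_closed_le, continuous_R_affine, (dist_continuous _ _ _ Hp), Hc. }
  pose proof (proj2 (proj2 (proj2 Hp))) as Hlip.
  intros x. specialize (Hlim x). rewrite converges_metric in Hlim. split.
  - intros [k [m H]]. apply NNPP. intros HV.
    assert (Hk : 0 < / INR (k + 1)) by (apply Rinv_0_lt_compat, lt_0_INR; lia).
    destruct (Hlim _ Hk) as [N HN]. specialize (HN (m + N)%nat ltac:(lia)). specialize (H N).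
    pose proof (proj1 (proj2 Hp) (fn (m + N)%nat x) (f x) HV). lra.
  - intros HV. apply d_topology in oV. destruct (oV _ HV) as [e [He Hb]].
    (* The minimum with 1 accounts for the truncation of [p]. Half of this distance is then given up
       to the convergence of [fn]. *)
    assert (Hpe : Rmin 1 e <= p (f x)).
    { apply Rnot_lt_le. intros h.
      destruct (proj1 (proj2 (proj2 Hp)) _ _ (Rmin_l 1 e) h) as [z [Hz Hd]].
      apply Hz, Hb. pose proof (Rmin_r 1 e). lra. }
    assert (Hpos : 0 < Rmin 1 e) by (apply Rmin_glb_lt; lra).
    destruct (archimed_cor1 (Rmin 1 e / 2) ltac:(lra)) as [N [HN HN0]].
    destruct (Hlim (Rmin 1 e / 2) ltac:(lra)) as [m Hm].
    exists N, m. intros l. specialize (Hm (m + l)%nat ltac:(lia)).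
    specialize (Hlip (f x) (fn (m + l)%nat x)). rewrite d_sym in Hlip.
    assert (/ INR (N + 1) <= / INR N).
    { apply Rinv_le_contravar; [apply lt_0_INR; lia|apply le_INR; lia]. }
    lra.
Qed.

(* Stone's construction: [i] is the least centre within [eps] of [y] in a well-ordering of [Y]. *)
Lemma stone_cover eps :
  0 < eps ->
  exists E : nat -> Y -> Y -> Prop,
    (forall y, exists m i, E m i y) /\
    (forall m i y, E m i y -> d i y < eps /\ / INR (m + 1) <= eps) /\
    (forall m i j y z, E m i y -> E m j z -> d y z < / INR (m + 1) -> i = j).
Proof.
  intros Heps. destruct (strict_well_order Y) as [lt [Hmin Htot]].
  (* The slack [/ INR (m + 1)] separates the cells: a point closer than that to the cell of [i] is
     within [eps] of [i], so it lies in no cell of a later centre. *)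
  exists (fun m i y => d i y + / INR (m + 1) <= eps /\ forall j, lt j i -> eps <= d j y).
  assert (Hpos : forall n, 0 < / INR (n + 1)).
  { intros n. apply Rinv_0_lt_compat, lt_0_INR. lia. }
  split; [|split].
  - intros y. destruct (Hmin (fun i => d i y < eps)) as [i [Hi Hlt]].
    { exists y. rewrite d_refl; exact Heps. }
    destruct (archimed_cor1 (eps - d i y) ltac:(lra)) as [m [Hm Hm0]].
    exists m, i. split.
    + assert (/ INR (m + 1) <= / INR m).
      { apply Rinv_le_contravar; [apply lt_0_INR; lia|apply le_INR; lia]. }
      lra.
    + intros j Hj. apply Rnot_lt_le, Hlt, Hj.
  - intros m i y [H _]. specialize (Hpos m). pose proof (d_ge0 i y). lra.
  - intros m i j y z [Hi Hi'] [Hj Hj'] Hyz. apply NNPP. intros Hne.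
    destruct (Htot i j Hne) as [h|h].
    + specialize (Hj' i h). pose proof (d_tri i y z). lra.
    + specialize (Hi' j h). pose proof (d_tri j z y). rewrite (d_sym z y) in *. lra.
Qed.

Lemma Baire1_Sigma_f {X : TopSpace} (f : X -> Y) : Baire1 f -> Sigma_f f.
Proof.
  intros [fn [Hc Hlim]].
  assert (Hpos : forall n, 0 < / INR (n + 1)).
  { intros n. apply Rinv_0_lt_compat, lt_0_INR. lia. }
  destruct (choice _ (fun k => stone_cover _ (Hpos k))) as [E HE].
  assert (Hp : forall q : nat * nat * Y, exists p, is_dist (E (fst (fst q)) (snd (fst q)) (snd q)) p)
    by (intros q; apply dist_exists).
  apply choice in Hp. destruct Hp as [p Hp].
  (* Cells of layer [m] are [8 * delta m] apart. The discreteness argument below spends 2 + 1 + 1 +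
     2 = 6 of these units. *)
  pose (delta := fun m => / INR (m + 1) / 8).
  assert (Hdelta : forall m, 0 < delta m /\ 8 * delta m <= 1).
  { intros m. unfold delta. specialize (Hpos m).
    assert (/ INR (m + 1) <= / 1).
    { apply Rinv_le_contravar; [lra|]. apply (le_INR 1). lia. }
    lra. }
  pose (B := fun k m j i x => forall l, (j <= l)%nat -> p (k, m, i) (fn l x) <= delta m).
  exists (fun _ => carrier Y).
  exists (fun n i => B (fst (of_nat (fst (of_nat n)))) (snd (of_nat (fst (of_nat n))))
                       (snd (of_nat n)) i).
  split.
  - intros n. set (k := fst (of_nat (fst (of_nat n)))). set (m := snd (of_nat (fst (of_nat n)))).
    set (j := snd (of_nat n)). destruct (Hdelta m) as [Hd0 Hd1].
    (* The enlargement looks at [fn j] alone. On [B] the distance is at most [delta m], and passing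
       to a closure point adds less than another [delta m]. *)
    exists (fun i x => p (k, m, i) (fn j x) < 2 * delta m). split; [|split].
    + intros i. apply functionally_open_lt, (dist_continuous _ _ _ (Hp (k, m, i))), Hc.
    + intros x. destruct (locally_ball (fn j) x (delta m) (Hc j) Hd0) as [W [oW [Wx HW]]].
      exists W. split; [exact oW|]. split; [exact Wx|].
      intros i i' [z [Wz Hz]] [z' [Wz' Hz']].
      apply (Hp (k, m, i)) in Hz; [|lra]. apply (Hp (k, m, i')) in Hz'; [|lra].
      destruct Hz as [e [He Hze]]. destruct Hz' as [e' [He' Hze']].
      refine (proj2 (proj2 (HE k)) m i i' e e' He He' _).
      apply HW in Wz. apply HW in Wz'.
      pose proof (d_tri e (fn j z) e'). pose proof (d_tri (fn j z) (fn j x) e').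
      pose proof (d_tri (fn j x) (fn j z') e').
      rewrite (d_sym e (fn j z)) in *. rewrite (d_sym (fn j z) (fn j x)) in *.
      unfold delta in *. lra.
    + intros i x Hx.
      destruct (locally_ball (fn j) x (delta m) (Hc j) Hd0) as [W [oW [Wx HW]]].
      destruct (Hx W oW Wx) as [z [Wz Bz]]. apply HW in Wz. specialize (Bz j (Nat.le_refl j)).
      pose proof (proj2 (proj2 (proj2 (Hp (k, m, i)))) (fn j x) (fn j z)). lra.
  - intros V oV x. split; [|intros [i [Bi Hi]]; auto].
    intros HV. apply d_topology in oV. destruct (oV _ HV) as [e [He Hb]].
    (* From [f x] to the centre [i], on to a point [w] of the cell, and from there to [f z]: each of
       the three distances is below [/ INR (k + 1)], hence below [e / 4]. *)
    destruct (archimed_cor1 (e / 4) ltac:(lra)) as [k [Hk Hk0]].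
    assert (/ INR (k + 1) <= / INR k).
    { apply Rinv_le_contravar; [apply lt_0_INR; lia|apply le_INR; lia]. }
    destruct (HE k) as [Ecov [Esmall _]].
    destruct (Ecov (f x)) as [m [i Hi]]. destruct (Esmall _ _ _ Hi) as [Hix Hmk].
    destruct (Hdelta m) as [Hd0 Hd1].
    pose proof (Hlim x) as Hx. rewrite converges_metric in Hx.
    destruct (Hx _ Hd0) as [j Hj].
    exists (existT (fun _ => carrier Y) (to_nat (to_nat (k, m), j)) i).
    cbn [projT1 projT2]. rewrite cancel_of_to. cbn [fst snd]. rewrite cancel_of_to.
    cbn [fst snd]. split.
    + intros l Hl. eapply Rle_trans; [apply (proj1 (proj2 (Hp (k, m, i))) _ (f x)); exact Hi|].
      left. apply Hj, Hl.
    + intros z Bz. apply Hb.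
      pose proof (Hlim z) as Hz. rewrite converges_metric in Hz.
      destruct (Hz _ Hd0) as [N HN]. specialize (HN (Nat.max N j) ltac:(lia)).
      specialize (Bz (Nat.max N j) ltac:(lia)).
      pose proof (proj2 (proj2 (proj2 (Hp (k, m, i)))) (f z) (fn (Nat.max N j) z)) as Hl.
      rewrite d_sym in Hl.
      destruct (proj1 (proj2 (proj2 (Hp (k, m, i)))) (f z) (3 * delta m)) as [w [Hw Hzw]]; [lra..|].
      destruct (Esmall m i w Hw) as [Hiw _].
      pose proof (d_tri (f x) i (f z)). pose proof (d_tri i w (f z)).
      rewrite (d_sym w (f z)) in *. rewrite (d_sym (f x) i) in *.
      unfold delta in *. lra.
Qed.

End Metric.

(** * Paths *)

Lemma R_open_full : R_open (fun _ => True).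
Proof. intros x _. exists 1. split; [lra|auto]. Qed.

Lemma R_open_inter U V : R_open U -> R_open V -> R_open (fun x => U x /\ V x).
Proof.
  intros HU HV x [Ux Vx]. destruct (HU x Ux) as [a [Ha HUa]]. destruct (HV x Vx) as [b [Hb HVb]].
  exists (Rmin a b). split; [apply Rmin_glb_lt; auto|]. intros y Hy.
  pose proof (Rmin_l a b). pose proof (Rmin_r a b). split; [apply HUa|apply HVb]; lra.
Qed.

Lemma R_open_union (F : (R -> Prop) -> Prop) :
  (forall U, F U -> R_open U) -> R_open (fun x => exists U, F U /\ U x).
Proof.
  intros HF x [U [FU Ux]]. destruct (HF U FU x Ux) as [e [He H]].
  exists e. split; [exact He|]. intros y Hy. exists U. auto.
Qed.

(** With the real line as a [TopSpace], the lemmas on [locally] and continuity also apply to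
    functions of a path parameter. *)
Definition R_top : TopSpace :=
  {| carrier := R; is_open := R_open; open_full := R_open_full;
     open_inter := R_open_inter; open_union := R_open_union |}.

Lemma continuous_R_id : @continuous_to_R R_top (fun t => t).
Proof. intros W HW. exact HW. Qed.

Lemma continuous_comp_R {X Y : TopSpace} (g : R -> Y) (phi : X -> R) :
  @continuous R_top Y g -> continuous_to_R phi -> continuous (fun x => g (phi x)).
Proof. intros Hg Hphi V oV. exact (Hphi _ (Hg V oV)). Qed.

Lemma continuous_const {X Y : TopSpace} (y : Y) : continuous (fun _ : X => y).
Proof. intros V _. apply open_prop. Qed.

(* Paths are parametrised by all of [R] and constant outside [0,1]. *)
Definition is_path {Y : TopSpace} (A : Y -> Prop) (y z : Y) (g : R -> Y) : Prop :=
  @continuous R_top Y g /\ (forall t, t <= 0 -> g t = y) /\ (forall t, 1 <= t -> g t = z) /\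
  forall t, A (g t).

Definition path_connected {Y : TopSpace} (A : Y -> Prop) : Prop :=
  forall y z, A y -> A z -> exists g, is_path A y z g.

Lemma is_path_weaken {Y : TopSpace} (A B : Y -> Prop) y z g :
  (forall x, A x -> B x) -> is_path A y z g -> is_path B y z g.
Proof. intros H [h1 [h2 [h3 h4]]]. repeat split; auto. Qed.

Lemma is_path_const {Y : TopSpace} (A : Y -> Prop) y : A y -> is_path A y y (fun _ => y).
Proof. intros Ay. split; [exact (@continuous_const R_top Y y)|auto]. Qed.

(** The open set [W] supplied by [is_arc] is correct only on [0,1]; clamping keeps the parameter
    there. *)
Lemma is_path_of_arc {Y : TopSpace} (A : Y -> Prop) g :
  is_arc g -> (forall t, unit_I t -> A (g t)) ->
  is_path A (g 0) (g 1) (fun t => g (Rmin 1 (Rmax 0 t))).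
Proof.
  intros [Hg _] HA.
  assert (Hunit : forall t, unit_I (Rmin 1 (Rmax 0 t))).
  { intros t. unfold unit_I, Rmin, Rmax. repeat destruct Rle_dec; lra. }
  split; [|split; [|split]].
  - intros V oV. destruct (Hg V oV) as [W [oW HW]].
    assert (Hc : @continuous_to_R R_top (fun t => Rmin 1 (Rmax 0 t))).
    { apply continuous_R_min; [apply continuous_R_const|].
      apply continuous_R_max; [apply continuous_R_const|apply continuous_R_id]. }
    apply (@open_iff R_top (fun t => W (Rmin 1 (Rmax 0 t)))); [|exact (Hc W oW)].
    intros t. symmetry. apply HW, Hunit.
  - intros t Ht. f_equal. unfold Rmin, Rmax. repeat destruct Rle_dec; lra.
  - intros t Ht. f_equal. unfold Rmin, Rmax. repeat destruct Rle_dec; lra.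
  - intros t. apply HA, Hunit.
Qed.

Lemma arcwise_path_connected {Y : TopSpace} (A : Y -> Prop) :
  arcwise_connected A -> path_connected A.
Proof.
  intros HA y z Ay Az. destruct (classic (y = z)) as [<-|Hne].
  - exists (fun _ => y). apply is_path_const, Ay.
  - destruct (HA y z Ay Az Hne) as [g [Hg [<- [<- Hin]]]].
    eexists. apply is_path_of_arc; auto.
Qed.

Lemma is_path_concat {Y : TopSpace} (A : Y -> Prop) x y z g h :
  is_path A x y g -> is_path A y z h -> exists k, is_path A x z k.
Proof.
  intros [gc [g0 [g1 gA]]] [hc [h0 [h1 hA]]].
  (* [g] has already reached [y] at [t = 1/3] and [h] only leaves it at [t = 2/3],
     so the two pieces agree on an open interval. *)
  pose (k := fun t => if Rlt_dec t (1/2) then g (3 * t + 0) else h (3 * t + -2)).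
  exists k. split; [|split; [|split]].
  - assert (Hlin : forall b, @continuous_to_R R_top (fun t => 3 * t + b))
      by (intros b; apply (@continuous_R_affine R_top), continuous_R_id).
    apply (@continuous_local_eq R_top). intros t. destruct (Rlt_dec t (2/3)) as [ht|ht].
    + exists (fun s => g (3 * s + 0)).
      split; [apply (@continuous_comp_R R_top); auto|].
      apply locally_imp with (2 := continuous_R_lt _ _ _ continuous_R_id ht).
      intros s hs. unfold k. destruct Rlt_dec; [reflexivity|].
      rewrite h0, g1; [reflexivity|lra..].
    + exists (fun s => h (3 * s + -2)).
      split; [apply (@continuous_comp_R R_top); auto|].
      assert (ht' : 1/3 < t) by lra.
      apply locally_imp with (2 := continuous_R_gt _ _ _ continuous_R_id ht').
      intros s hs. unfold k. destruct Rlt_dec; [|reflexivity].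
      rewrite h0, g1; [reflexivity|lra..].
  - intros t Ht. unfold k. destruct Rlt_dec; [apply g0|]; lra.
  - intros t Ht. unfold k. destruct Rlt_dec; [|apply h1]; lra.
  - intros t. unfold k. destruct Rlt_dec; auto.
Qed.

(** The set of points reachable from [y] and its complement are both open, because nearby points are
    joined by paths in either direction. *)
Lemma connected_path_connected (Y : TopSpace) :
  connected Y -> locally_arcwise_connected Y -> @path_connected Y (fun _ => True).
Proof.
  intros Hconn Hloc y z _ _. apply NNPP. intros Hno. apply Hconn.
  exists (fun w => exists g, is_path (fun _ => True) y w g),
         (fun w => ~ exists g, is_path (fun _ => True) y w g).
  assert (Hnbhd : forall w, locally w (fun v => exists g h : R -> Y,
             is_path (fun _ => True) w v g /\ is_path (fun _ => True) v w h)).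
  { intros w. destruct (Hloc w _ (open_full Y) I) as [V [oV [Vw [_ HV]]]].
    apply arcwise_path_connected in HV.
    apply locally_imp with (2 := locally_open V w oV Vw). intros v Vv.
    destruct (HV w v Vw Vv) as [g Hg]. destruct (HV v w Vv Vw) as [h Hh].
    exists g, h. split; eapply is_path_weaken; eauto; auto. }
  split; [|split; [|split; [|split; [|split]]]].
  - apply open_locally. intros w [p Hp].
    apply locally_imp with (2 := Hnbhd w). intros v [g [_ [Hg _]]].
    exact (is_path_concat _ _ _ _ _ _ Hp Hg).
  - apply open_locally. intros w Hw.
    apply locally_imp with (2 := Hnbhd w). intros v [_ [h [_ Hh]]] [p Hp].
    exact (Hw (is_path_concat _ _ _ _ _ _ Hp Hh)).
  - exists y, (fun _ => y). apply is_path_const, I.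
  - exists z. exact Hno.
  - intros w. apply classic.
  - intros w [h1 h2]. auto.
Qed.

(** * Patching discrete families of labelled sets *)

(* A discrete family of labelled sets, each carrying a function [q i] that is at least [1] off
   the set, is encoded by one function and one label map, locally constant where [h < 1]. *)
Lemma discrete_family_glue {X : TopSpace} {I L : Type}
  (U : I -> X -> Prop) (q : I -> X -> R) (lab : I -> L) (l0 : L) :
  discrete_family U -> (forall i, continuous_to_R (q i)) ->
  (forall i x, ~ U i x -> 1 <= q i x) ->
  exists (h : X -> R) (l : X -> L),
    continuous_to_R h /\
    (forall x, h x < 1 -> locally x (fun z => l z = l x)) /\
    (forall i x, U i x -> h x = Rmin 1 (q i x) /\ l x = lab i) /\
    (forall x, (forall i, ~ U i x) -> h x = 1 /\ l x = l0).
Proof.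
  intros HU Hq Hoff.
  assert (Huniq : forall i j x, U i x -> U j x -> i = j).
  { intros i j x Hi Hj. destruct (HU x) as [W [_ [Wx HW]]]. apply HW; eauto. }
  assert (Hex : forall x, exists p : R * L,
    (forall i, U i x -> fst p = Rmin 1 (q i x) /\ snd p = lab i) /\
    ((forall i, ~ U i x) -> fst p = 1 /\ snd p = l0)).
  { intros x. destruct (classic (exists i, U i x)) as [[i Hi]|Hno].
    - exists (Rmin 1 (q i x), lab i). split; [|intros H; destruct (H i Hi)].
      intros j Hj. rewrite (Huniq i j x Hi Hj). auto.
    - exists (1, l0). split; [|auto]. intros i Hi. destruct Hno; eauto. }
  apply choice in Hex. destruct Hex as [p Hp].
  exists (fun x => fst (p x)), (fun x => snd (p x)). split; [|split; [|split]].
  - apply continuous_R_local_eq. intros x. destruct (HU x) as [W [oW [Wx HW]]].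
    destruct (classic (exists i z, W z /\ U i z)) as [[i [w [Ww Uw]]]|Hno].
    + exists (fun z => Rmin 1 (q i z)).
      split; [apply continuous_R_min; [apply continuous_R_const|auto]|].
      apply locally_imp with (2 := locally_open W x oW Wx). intros z Wz.
      destruct (classic (U i z)) as [Uz|Uz]; [apply (Hp z), Uz|].
      (* Off [U i] the lower bound on [q i] makes both sides 1, since no other member of the family
         meets [W]. *)
      rewrite Rmin_left by auto. apply (Hp z). intros j Uj.
      apply Uz. rewrite (HW i j); eauto.
    + exists (fun _ => 1). split; [apply continuous_R_const|].
      apply locally_imp with (2 := locally_open W x oW Wx). intros z Wz.
      apply (Hp z). intros i Ui. apply Hno; eauto.
  - intros x Hx. destruct (classic (exists i, U i x)) as [[i Hi]|Hno].
    + destruct (proj1 (Hp x) i Hi) as [E1 E2]. rewrite E1 in Hx. rewrite E2.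
      (* The strict inequality persists near [x], and it keeps nearby points inside [U i], where the
         label is [lab i]. *)
      assert (Hqx : q i x < 1) by (unfold Rmin in Hx; destruct Rle_dec; lra).
      apply locally_imp with (2 := continuous_R_lt _ _ _ (Hq i) Hqx). intros z Hz.
      apply (Hp z). apply NNPP. intros Hn. specialize (Hoff i z Hn). lra.
    + destruct (proj2 (Hp x)) as [E _]; [|lra]. intros i Hi; apply Hno; eauto.
  - intros i x. apply (Hp x).
  - intros x. apply (Hp x).
Qed.

(* On the first [n] of the functions [h], [patch_weight] is positive exactly near the points whose
   first small value [h m x] is clearly below [1/c], the earlier ones being clearly above it. *)
Fixpoint patch_weight {X : Type} (c : R) (n : nat) (h : nat -> X -> R) (x : X) : R :=
  match n with
  | O => -1
  | S n' => Rmax (1 - c * h O x) (Rmin (c * h O x - 1) (patch_weight c n' (fun m => h (S m)) x))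
  end.

(** The base case is a default: it is reached only where [1 <= c * h m x] for all [m < n], and there
    [patch_weight] is not positive. *)
Fixpoint patch_label {X L : Type} (c : R) (n : nat) (h : nat -> X -> R) (l : nat -> X -> L)
  (x : X) : L :=
  match n with
  | O => l O x
  | S n' => if Rlt_dec 0 (1 - c * h O x) then l O x
            else patch_label c n' (fun m => h (S m)) (fun m => l (S m)) x
  end.

Lemma patch_weight_continuous {X : TopSpace} c n (h : nat -> X -> R) :
  (forall m, continuous_to_R (h m)) -> continuous_to_R (patch_weight c n h).
Proof.
  revert h. induction n as [|n IH]; intros h Hh; simpl.
  - apply continuous_R_const.
  - assert (H : forall a b, continuous_to_R (fun x => a * h O x + b))
      by (intros a b; apply continuous_R_affine, Hh).
    apply continuous_R_max; [|apply continuous_R_min].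
    + replace (fun x => 1 - c * h O x) with (fun x => - c * h O x + 1); [apply H|].
      apply functional_extensionality; intros x; ring.
    + apply (H c (-1)).
    + apply IH. auto.
Qed.

Lemma patch_label_ind {X L : Type} (P : L -> Prop) c n (h : nat -> X -> R) l x :
  (forall m, P (l m x)) -> P (patch_label c n h l x).
Proof.
  revert h l. induction n as [|n IH]; intros h l H; simpl; [auto|].
  destruct Rlt_dec; auto.
Qed.

(** Where the weight is positive, every comparison with [1 / c] made on the way to the label is
    strict, so nearby points take the same branches. [1 <= c] places the chosen [h m x] below 1,
    where [l m] is locally constant. *)
Lemma patch_label_locally_constant {X : TopSpace} {L : Type} c n (h : nat -> X -> R)
  (l : nat -> X -> L) x :
  1 <= c -> (forall m, continuous_to_R (h m)) ->
  (forall m x, h m x < 1 -> locally x (fun z => l m z = l m x)) ->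
  0 < patch_weight c n h x ->
  locally x (fun z => patch_label c n h l z = patch_label c n h l x).
Proof.
  intros Hc. revert h l. induction n as [|n IH]; intros h l Hh Hl; simpl; [lra|].
  intros Hpos. destruct (Rlt_dec 0 (1 - c * h O x)) as [h0|h0].
  - assert (H1 : h O x < / c).
    { apply Rmult_lt_reg_l with c; [lra|]. rewrite Rinv_r; lra. }
    assert (H2 : / c <= 1) by (rewrite <- Rinv_1; apply Rinv_le_contravar; lra).
    apply locally_imp with
      (2 := locally_and _ _ _ (continuous_R_lt _ _ _ (Hh O) H1) (Hl O x ltac:(lra))).
    intros z [Hz E]. destruct Rlt_dec as [hz|hz]; [exact E|]. exfalso; apply hz.
    apply Rmult_lt_compat_l with (r := c) in Hz; [|lra]. rewrite Rinv_r in Hz; lra.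
  - assert (H : 0 < c * h O x - 1 /\ 0 < patch_weight c n (fun m => h (S m)) x).
    { unfold Rmax, Rmin in Hpos; repeat destruct Rle_dec; lra. }
    destruct H as [H1 H2].
    assert (H3 : 1 < c * h O x + 0) by lra.
    apply locally_imp with
      (2 := locally_and _ _ _ (continuous_R_gt _ _ _ (continuous_R_affine _ c 0 (Hh O)) H3)
              (IH (fun m => h (S m)) (fun m => l (S m)) (fun m => Hh (S m))
                  (fun m => Hl (S m)) H2)).
    intros z [Hz E]. destruct Rlt_dec; [lra|]. exact E.
Qed.

(** The bound 2 leaves [c * h k x - 1] at least 1 at each skipped index, so the minima do not cut
    off the value 1 contributed by index [m]. *)
Lemma patch_first {X L : Type} c n m (h : nat -> X -> R) (l : nat -> X -> L) x :
  (m < n)%nat -> h m x = 0 -> (forall k, (k < m)%nat -> 2 <= c * h k x) ->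
  1 <= patch_weight c n h x /\ patch_label c n h l x = l m x.
Proof.
  revert n h l. induction m as [|m IH]; intros [|n] h l Hmn H0 Hk; try lia; simpl.
  - rewrite H0, Rmult_0_r. split; [eapply Rle_trans; [|apply Rmax_l]; lra|]. destruct Rlt_dec; [reflexivity|lra].
  - specialize (IH n (fun m => h (S m)) (fun m => l (S m)) ltac:(lia) H0
                  (fun k hk => Hk (S k) ltac:(lia))).
    specialize (Hk O ltac:(lia)). destruct IH as [IH1 IH2]. rewrite IH2. split.
    + unfold Rmax, Rmin; repeat destruct Rle_dec; lra.
    + destruct Rlt_dec; [lra|reflexivity].
Qed.

Lemma least_exists (P : nat -> Prop) :
  (exists n, P n) -> exists n, P n /\ forall k, (k < n)%nat -> ~ P k.
Proof.
  intros [n Hn]. induction n as [n IH] using lt_wf_ind.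
  destruct (classic (exists k, (k < n)%nat /\ P k)) as [[k [Hk Pk]]|Hno]; [eauto|].
  exists n. split; [exact Hn|]. intros k Hk Pk. eauto.
Qed.

Lemma eventually_forall_lt (P : nat -> nat -> Prop) m :
  (forall k, (k < m)%nat -> exists N, forall n, (N <= n)%nat -> P k n) ->
  exists N, forall n, (N <= n)%nat -> forall k, (k < m)%nat -> P k n.
Proof.
  induction m as [|m IH]; intros H; [exists O; intros; lia|].
  destruct IH as [N1 H1]; [intros k hk; apply H; lia|].
  destruct (H m ltac:(lia)) as [N2 H2]. exists (Nat.max N1 N2). intros n Hn k Hk.
  destruct (Nat.eq_dec k m) as [->|]; [apply H2|apply H1]; lia.
Qed.

(** * Approximation by continuous maps *)

Section Approximation.
Context {X Y : TopSpace} (d : Y -> Y -> R).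
Hypothesis d_metric : is_metric d.
Hypothesis d_topology : forall U : Y -> Prop, is_open U <-> metric_open d U.
Hypothesis Y_connected : connected Y.
Hypothesis Y_loc_arcwise : locally_arcwise_connected Y.

Let d_refl : forall x, d x x = 0 :=
  fun x => proj2 (proj1 (proj2 d_metric) x x) eq_refl.
Let d_sym : forall x y, d x y = d y x := proj1 (proj2 (proj2 d_metric)).
Let d_tri : forall x y z, d x z <= d x y + d y z := proj2 (proj2 (proj2 d_metric)).

Definition small_region (eps : R) (W : Y -> Prop) : Prop :=
  is_open W /\ path_connected W /\ forall y z, W y -> W z -> d y z <= eps.

Lemma small_region_exists eps y : 0 < eps -> exists W, small_region eps W /\ W y.
Proof.
  intros He. destruct (Y_loc_arcwise y (fun z => d y z < eps / 2)) as [W [oW [Wy [HW Hpc]]]].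
  - apply (open_ball d d_metric d_topology).
  - rewrite d_refl; lra.
  - exists W. split; [|exact Wy]. split; [exact oW|]. split; [apply arcwise_path_connected, Hpc|].
    intros u v Wu Wv. apply HW in Wu, Wv. pose proof (d_tri u y v).
    rewrite (d_sym u y) in *. lra.
Qed.

(** The preimage of the region [W] of a base element is a countable union of zero sets by [K1]. Each
    is intersected with a set [1 <= k * u] inside the functionally open neighbourhood of that
    element. For a fixed triple of layer, zero set and [k], these closed sets form a discrete
    family, which is glued into one pair [h], [l]. *)
Lemma closed_patches (f : X -> Y) (y0 : Y) eps :
  K1 f -> Sigma_f f -> 0 < eps ->
  exists (h : nat -> X -> R) (l : nat -> X -> Y -> Prop),
    (forall m, continuous_to_R (h m)) /\
    (forall m x, small_region eps (l m x)) /\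
    (forall m x, h m x < 1 -> locally x (fun z => l m z = l m x)) /\
    (forall m x, 0 <= h m x) /\
    (forall m x, h m x = 0 -> l m x (f x)) /\
    (forall x, exists m, h m x = 0).
Proof.
  intros HK [I [B [Hsfd Hbase]]] He.
  assert (HU : forall n, exists u : I n -> X -> R,
     discrete_family (fun i x => 0 < u i x) /\ (forall i x, B n i x -> 0 < u i x) /\
     forall i, continuous_to_R (u i) /\ forall x, 0 <= u i x).
  { intros n. destruct (Hsfd n) as [U [Hopen [Hdisc Hcl]]].
    apply choice in Hopen. destruct Hopen as [u Hu]. exists u.
    assert (HUu : forall i x, U i x <-> 0 < u i x).
    { intros i x. destruct (Hu i) as [_ [Hr Hz]]. specialize (Hr x). specialize (Hz x).
      split; intros H.
      - destruct (Rle_lt_or_eq_dec 0 (u i x)) as [h|h]; [lra|exact h|]. symmetry in h. tauto.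
      - apply NNPP. intros h. apply Hz in h. lra. }
    split; [|split].
    - replace (fun i x => 0 < u i x) with U; [exact Hdisc|].
      apply functional_extensionality; intros i. apply pred_ext, HUu.
    - intros i x Bx. apply HUu, Hcl. intros W _ Wx. eauto.
    - intros i. destruct (Hu i) as [Hc [Hr _]]. split; [exact Hc|]. intros x; apply Hr. }
  (* The index type [I n] varies with [n], so [u] is a dependent choice function. *)
  pose (u := fun n => proj1_sig (constructive_indefinite_description _ (HU n))).
  assert (Hu : forall n, discrete_family (fun i x => 0 < u n i x) /\
     (forall i x, B n i x -> 0 < u n i x) /\
     forall i, continuous_to_R (u n i) /\ forall x, 0 <= u n i x)
    by (intros n; exact (proj2_sig (constructive_indefinite_description _ (HU n)))).
  clearbody u. clear HU.
  destruct (small_region_exists eps y0 He) as [W0 [HW0 _]].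
  (* Base elements whose image fits in no small region get the default [W0]. This is harmless, since
     [z] below vanishes only at points that [f] sends into the assigned region. *)
  assert (HW : forall s : {n : nat & I n}, exists W, small_region eps W /\
     ((exists W', small_region eps W' /\ forall z, B (projT1 s) (projT2 s) z -> W' (f z)) ->
      forall z, B (projT1 s) (projT2 s) z -> W (f z))).
  { intros s. destruct (classic (exists W', small_region eps W' /\
                          forall z, B (projT1 s) (projT2 s) z -> W' (f z))) as [[W [H1 H2]]|Hno].
    - exists W. auto.
    - exists W0. split; [exact HW0|]. tauto. }
  apply choice in HW. destruct HW as [W HW].
  assert (Hz : forall s, exists z : nat -> X -> R,
     (forall l, continuous_to_R (z l) /\ forall x, 0 <= z l x) /\
     forall x, W s (f x) <-> exists l, z l x = 0).
  { intros s. destruct (HK (W s) (proj1 (proj1 (HW s)))) as [F [HF HFW]].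
    apply choice in HF. destruct HF as [z Hz]. exists z. split.
    - intros l. destruct (Hz l) as [Hc [Hr _]]. split; [exact Hc|]. intros x; apply Hr.
    - intros x. rewrite HFW. split; intros [l Hl]; exists l; apply (Hz l); exact Hl. }
  apply choice in Hz. destruct Hz as [z Hz].
  assert (Hpatch : forall p : nat * nat * nat, exists hl : (X -> R) * (X -> Y -> Prop),
    continuous_to_R (fst hl) /\
    (forall x, small_region eps (snd hl x)) /\
    (forall x, fst hl x < 1 -> locally x (fun z => snd hl z = snd hl x)) /\
    (forall x, 0 <= fst hl x) /\
    (forall x, fst hl x = 0 -> snd hl x (f x)) /\
    forall i x, 1 <= INR (snd p) * u (fst (fst p)) i x ->
       z (existT _ (fst (fst p)) i) (snd (fst p)) x = 0 -> fst hl x = 0).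
  { intros [[n l] k]. cbn [fst snd]. destruct (Hu n) as [Hdisc [_ Hun]].
    (* The maximum is 0 exactly where [z] vanishes and [1 <= INR k * u], and it is at least 1 where
       [u] vanishes. *)
    destruct (discrete_family_glue (fun i x => 0 < u n i x)
                (fun i x => Rmax (z (existT _ n i) l x) (- INR k * u n i x + 1))
                (fun i => W (existT _ n i)) W0 Hdisc) as [h [lab [Hh [Hlab [Hon Hoff]]]]].
    { intros i. apply continuous_R_max; [apply Hz|apply continuous_R_affine, Hun]. }
    { intros i x Hx. assert (E : u n i x = 0).
      { destruct (Hun i) as [_ H]. specialize (H x). lra. }
      rewrite E. eapply Rle_trans; [|apply Rmax_r]. lra. }
    exists (h, lab). cbn [fst snd].
    assert (Hcase : forall x, (exists i, 0 < u n i x) \/ (forall i, ~ 0 < u n i x)).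
    { intros x. destruct (classic (exists i, 0 < u n i x)); [auto|]. right. eauto. }
    assert (Hz0 : forall s x, 0 <= z s l x) by (intros s; apply Hz).
    split; [exact Hh|]. split; [|split; [exact Hlab|split; [|split]]].
    - intros x. destruct (Hcase x) as [[i Hi]|Hno].
      + rewrite (proj2 (Hon i x Hi)). apply HW.
      + rewrite (proj2 (Hoff x Hno)). exact HW0.
    - intros x. destruct (Hcase x) as [[i Hi]|Hno].
      + rewrite (proj1 (Hon i x Hi)). specialize (Hz0 (existT _ n i) x).
        unfold Rmin, Rmax; repeat destruct Rle_dec; lra.
      + rewrite (proj1 (Hoff x Hno)). lra.
    - intros x Hx. destruct (Hcase x) as [[i Hi]|Hno].
      + destruct (Hon i x Hi) as [E1 E2]. rewrite E2. apply (Hz (existT _ n i)). exists l.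
        specialize (Hz0 (existT _ n i) x). rewrite E1 in Hx.
        unfold Rmin, Rmax in Hx; repeat destruct Rle_dec; lra.
      + rewrite (proj1 (Hoff x Hno)) in Hx. lra.
    - intros i x Hk Hzx.
      assert (Hi : 0 < u n i x).
      { destruct (Hun i) as [_ H]. specialize (H x). destruct (Req_dec (u n i x) 0) as [E|]; [|lra].
        rewrite E, Rmult_0_r in Hk. lra. }
      rewrite (proj1 (Hon i x Hi)), Hzx.
      unfold Rmin, Rmax; repeat destruct Rle_dec; lra. }
  apply choice in Hpatch. destruct Hpatch as [hl Hhl].
  pose (dec := fun m => (of_nat (fst (of_nat m)), snd (of_nat m))).
  exists (fun m => fst (hl (dec m))), (fun m => snd (hl (dec m))).
  repeat (split; [intros m; apply (Hhl (dec m))|]).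
  (* Covering: a base element at [x] with image in a small region [V] has an assigned region
     containing [f x]. This yields [l], and [k] comes from [0 < u n i x]. *)
  intros x. destruct (small_region_exists eps (f x) He) as [V [HV Vx]].
  destruct (proj1 (Hbase V (proj1 HV) x) Vx) as [[n i] [Bx HB]]. cbn [projT1 projT2] in *.
  assert (Wx : W (existT _ n i) (f x)).
  { apply (proj2 (HW (existT _ n i))); [|exact Bx]. exists V. auto. }
  apply Hz in Wx. destruct Wx as [l Hl].
  destruct (archimed_cor1 (u n i x) (proj1 (proj2 (Hu n)) i x Bx)) as [k [Hk Hk0]].
  exists (to_nat (to_nat (n, l), k)). unfold dec. rewrite cancel_of_to. cbn [fst snd].
  rewrite cancel_of_to.
  apply (Hhl (n, l, k)) with i; [|exact Hl]. cbn [fst snd].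
  assert (HkR : 0 < INR k) by (apply lt_0_INR; lia).
  apply Rmult_lt_compat_l with (r := INR k) in Hk; [|exact HkR].
  rewrite Rinv_r in Hk; lra.
Qed.

Lemma approximating_patches (f : X -> Y) (y0 : Y) eps :
  K1 f -> Sigma_f f -> 0 < eps ->
  exists (psi : nat -> X -> R) (l : nat -> X -> Y -> Prop),
    (forall n, continuous_to_R (psi n)) /\
    (forall n x, small_region eps (l n x)) /\
    (forall n x, 0 < psi n x -> locally x (fun z => l n z = l n x)) /\
    (forall x, exists N, forall n, (N <= n)%nat -> 1 <= psi n x /\ l n x (f x)).
Proof.
  intros HK HS He.
  destruct (closed_patches f y0 eps HK HS He) as [h [l [Hh [Hl [Hloc [Hge [Hf Hcov]]]]]]].
  (* Stage [n] keeps [n] families and uses the threshold [1 / (n + 1)]. If [m] is the first index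
     with [h m x = 0], the finitely many earlier values are positive and eventually exceed twice the
     threshold. *)
  exists (fun n => patch_weight (INR (n + 1)) n h), (fun n => patch_label (INR (n + 1)) n h l).
  split; [|split; [|split]].
  - intros n. apply patch_weight_continuous, Hh.
  - intros n x. apply patch_label_ind. auto.
  - intros n x. apply patch_label_locally_constant; auto. apply (le_INR 1). lia.
  - intros x. destruct (least_exists _ (Hcov x)) as [m [H0 Hlt]].
    destruct (eventually_forall_lt (fun k n => 2 <= INR (n + 1) * h k x) m) as [N HN].
    { intros k Hk. assert (Hpos : 0 < h k x).
      { specialize (Hge k x). specialize (Hlt k Hk). lra. }
      destruct (archimed_cor1 (h k x / 2) ltac:(lra)) as [N [HN HN0]]. exists N. intros n Hn.
      assert (HNR : 0 < INR N) by (apply lt_0_INR; lia).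
      apply Rmult_lt_compat_l with (r := INR N) in HN; [|exact HNR].
      rewrite Rinv_r in HN by lra.
      assert (INR N <= INR (n + 1)) by (apply le_INR; lia). nra. }
    exists (Nat.max N (S m)). intros n Hn.
    destruct (patch_first (INR (n + 1)) n m h l x) as [H1 H2]; [lia|exact H0|apply HN; lia|].
    rewrite H2. auto.
Qed.

(** * Labels, paths and the recursive construction *)

Definition label : Type := Y * (Y -> Prop).

(* If the new region misses the current one, the value stays put and gets a small region of its
   own: labels then stay valid at points where the weights of several levels are positive although
   the regions are unrelated. *)
Lemma label_transition :
  exists next : R -> label -> (Y -> Prop) -> label,
    forall eps p W', 0 < eps -> snd p (fst p) -> small_region eps W' ->
      snd p (fst (next eps p W')) /\ snd (next eps p W') (fst (next eps p W')) /\
      small_region eps (snd (next eps p W')) /\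
      ((exists z, snd p z /\ W' z) -> snd (next eps p W') = W').
Proof.
  assert (H : forall s : R * label * (Y -> Prop), exists q : label,
    0 < fst (fst s) -> snd (snd (fst s)) (fst (snd (fst s))) ->
    small_region (fst (fst s)) (snd s) ->
      snd (snd (fst s)) (fst q) /\ snd q (fst q) /\ small_region (fst (fst s)) (snd q) /\
      ((exists z, snd (snd (fst s)) z /\ snd s z) -> snd q = snd s)).
  { intros [[eps [y W]] W']; cbn [fst snd].
    destruct (classic (exists z, W z /\ W' z)) as [[z [Wz Wz']]|Hno].
    - exists (z, W'). auto.
    - destruct (classic (0 < eps)) as [He|He]; [|exists (y, W); tauto].
      destruct (small_region_exists eps y He) as [V [HV Vy]].
      exists (y, V). cbn [fst snd]. tauto. }
  apply choice in H. destruct H as [next H].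
  exists (fun eps p W' => next (eps, p, W')). intros eps p W'. apply (H (eps, p, W')).
Qed.

(** The path depends only on its end points and region, so points with equal labels move along the
    same path. *)
Lemma path_choice :
  exists path : Y -> Y -> (Y -> Prop) -> R -> Y,
    forall y z W, path_connected W -> W y -> W z -> is_path W y z (path y z W).
Proof.
  assert (H : forall s : Y * Y * (Y -> Prop), exists g, path_connected (snd s) ->
    snd s (fst (fst s)) -> snd s (snd (fst s)) -> is_path (snd s) (fst (fst s)) (snd (fst s)) g).
  { intros [[y z] W]; cbn [fst snd].
    destruct (classic (path_connected W /\ W y /\ W z)) as [[HW [Wy Wz]]|Hno].
    - destruct (HW y z Wy Wz) as [g Hg]. exists g. auto.
    - exists (fun _ => y). tauto. }
  apply choice in H. destruct H as [path H].
  exists (fun y z W => path (y, z, W)). intros y z W. apply (H (y, z, W)).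
Qed.

Section Recursion.
Variable f : X -> Y.
Variable psi : nat -> X -> R.
Variable l : nat -> X -> Y -> Prop.
Hypothesis psi_continuous : forall k, continuous_to_R (psi k).
Hypothesis l_small : forall k x, small_region ((1/2) ^ k) (l k x).
Hypothesis l_locally_constant :
  forall k x, 0 < psi k x -> locally x (fun z => l k z = l k x).

Definition good (n : nat) (x : X) : Prop :=
  forall k, (k < n)%nat -> 1 <= psi k x /\ l k x (f x).

Lemma half_pow_pos n : 0 < (1/2) ^ n.
Proof. apply pow_lt; lra. Qed.

(* A label [(y, W)] records the current value [y] and a region [W] around it. In the last clause, moving
   along a path in the current region costs at most [2 * (1/2) ^ n]. *)
Lemma refinement (y0 : Y) n :
  exists (g : X -> Y) (w : X -> R) (p : X -> label),
    continuous g /\ continuous_to_R w /\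
    (forall x, 0 < w x -> locally x (fun z => p z = p x)) /\
    (forall x, 0 < w x -> g x = fst (p x)) /\
    (forall x, path_connected (snd (p x)) /\ snd (p x) (fst (p x))) /\
    ((1 <= n)%nat -> forall x y z, snd (p x) y -> snd (p x) z -> d y z <= 2 * (1/2) ^ n) /\
    (forall x, good n x -> 1 <= w x /\ snd (p x) (f x)) /\
    (forall x j, (1 <= j <= n)%nat -> good j x ->
       d (g x) (f x) <= 6 * (1/2) ^ j - 4 * (1/2) ^ n).
Proof.
  induction n as [|n [g [w [p [Hg [Hw [Hloc [Hgp [Hp [Hdiam [Hgood Hbound]]]]]]]]]]].
  (* The initial region is all of [Y], which need not be bounded; hence the restriction of the
     metric clauses to levels at least 1. *)
  - exists (fun _ => y0), (fun _ => 1), (fun _ => (y0, fun _ => True)).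
    split; [apply continuous_const|]. split; [apply continuous_R_const|].
    split; [intros x _; apply locally_imp with (2 := locally_true x); auto|].
    split; [auto|]. split; [intros x; split; [apply connected_path_connected; auto|exact I]|].
    split; [lia|]. split; [intros x _; split; [lra|exact I]|]. lia.
  - destruct label_transition as [next Hnext]. destruct path_choice as [path Hpath].
    pose (chi := fun x => Rmin (w x) (psi n x)).
    pose (p' := fun x => next ((1/2) ^ n) (p x) (l n x)).
    assert (Hp' : forall x, snd (p x) (fst (p' x)) /\ snd (p' x) (fst (p' x)) /\
              small_region ((1/2) ^ n) (snd (p' x)) /\
              ((exists z, snd (p x) z /\ l n x z) -> snd (p' x) = l n x)).
    { intros x. apply Hnext; [apply half_pow_pos|apply Hp|apply l_small]. }
    pose (gam := fun x => path (fst (p x)) (fst (p' x)) (snd (p x))).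
    assert (Hgam : forall x, is_path (snd (p x)) (fst (p x)) (fst (p' x)) (gam x)).
    { intros x. apply Hpath; [apply Hp|apply Hp|apply Hp']. }
    (* The path is run while [chi] grows from 1/3 to 2/3. Below 1/3 the old value persists, and
       above 2/3, where the new weight [3 * chi x + -2] is positive, the new value is reached. *)
    pose (g' := fun x => if Rlt_dec 0 (chi x) then gam x (3 * chi x + -1) else g x).
    assert (Hchi : continuous_to_R chi) by (apply continuous_R_min; auto).
    assert (Hchipos : forall x, 0 < chi x -> 0 < w x /\ 0 < psi n x).
    { intros x Hx. unfold chi in Hx. pose proof (Rmin_l (w x) (psi n x)).
      pose proof (Rmin_r (w x) (psi n x)). lra. }
    assert (Hlabels : forall x, 0 < chi x -> locally x (fun z => p z = p x /\ l n z = l n x)).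
    { intros x Hx. destruct (Hchipos x Hx) as [H1 H2].
      exact (locally_and _ _ _ (Hloc x H1) (l_locally_constant n x H2)). }
    assert (Hgood' : forall x, good (S n) x ->
              1 <= 3 * chi x + -2 /\ snd (p' x) (f x)).
    { intros x Hx. destruct (Hgood x) as [H1 H2]; [intros k Hk; apply Hx; lia|].
      destruct (Hx n ltac:(lia)) as [H3 H4]. split.
      - unfold chi, Rmin; destruct Rle_dec; lra.
      (* The point [f x] lies in both the old and the proposed region, so the transition adopts
         [l n x]. *)
      - destruct (Hp' x) as [_ [_ [_ E]]]. rewrite E; eauto. }
    assert (Hgp' : forall x, 0 < 3 * chi x + -2 -> g' x = fst (p' x)).
    { intros x Hx. unfold g'. destruct Rlt_dec; [|lra]. apply (Hgam x). lra. }
    exists g', (fun x => 3 * chi x + -2), p'.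
    split; [|split; [|split; [|split; [|split; [|split; [|split]]]]]].
    + apply continuous_local_eq. intros x. destruct (Rlt_dec 0 (chi x)) as [hx|hx].
      * exists (fun z => gam x (3 * chi z + -1)). split.
        { apply continuous_comp_R; [apply (Hgam x)|]. apply continuous_R_affine, Hchi. }
        apply locally_imp with
          (2 := locally_and _ _ _ (continuous_R_gt _ _ _ Hchi hx) (Hlabels x hx)).
        intros z [Hz [E1 E2]]. unfold g'. destruct Rlt_dec; [|lra].
        unfold gam, p'. rewrite E1, E2. reflexivity.
      (* Near such a point [chi < 1/3], so wherever the path is used it is still at its start
         [fst (p z)], which is [g z]. *)
      * exists g. split; [exact Hg|].
        assert (hx' : chi x < 1/3) by lra.
        apply locally_imp with (2 := continuous_R_lt _ _ _ Hchi hx').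
        intros z Hz. unfold g'. destruct Rlt_dec as [hz|hz]; [|reflexivity].
        rewrite (Hgp z) by apply (Hchipos z hz). apply (Hgam z). lra.
    + apply continuous_R_affine, Hchi.
    + intros x Hx. apply locally_imp with (2 := Hlabels x ltac:(lra)).
      intros z [E1 E2]. unfold p'. rewrite E1, E2. reflexivity.
    + exact Hgp'.
    + intros x. destruct (Hp' x) as [_ [H1 [[_ [H2 _]] _]]]. auto.
    (* The region at level [S n] has the diameter bound [(1/2) ^ n] of level [n], which explains the
       factor 2. *)
    + intros _ x y z Hy Hz. destruct (Hp' x) as [_ [_ [[_ [_ H]] _]]].
      specialize (H y z Hy Hz). simpl. lra.
    + exact Hgood'.
    (* For [j = S n] both points lie in the new region, and 6 - 4 = 2 is the factor of its diameter
       bound. For smaller [j] the move costs [2 * (1/2) ^ n], exactly the increase of the bound from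
       [n] to [S n]. *)
    + intros x j Hj Hx. destruct (Nat.eq_dec j (S n)) as [->|Hne].
      * destruct (Hgood' x Hx) as [H1 H2]. rewrite (Hgp' x) by lra.
        destruct (Hp' x) as [_ [H3 [[_ [_ H]] _]]]. specialize (H _ _ H3 H2). simpl. lra.
      * assert (Hstep : d (g' x) (g x) <= 2 * (1/2) ^ n).
        { unfold g'. destruct Rlt_dec as [h|h].
          - rewrite (Hgp x) by apply (Hchipos x h).
            apply (Hdiam ltac:(lia) x); [apply (Hgam x)|apply Hp].
          - rewrite d_refl. pose proof (half_pow_pos n). lra. }
        specialize (Hbound x j ltac:(lia) Hx). pose proof (d_tri (g' x) (g x) (f x)).
        simpl. lra.
Qed.

End Recursion.

Lemma K1_Sigma_f_Baire1 (f : X -> Y) : K1 f -> Sigma_f f -> Baire1 f.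
Proof.
  intros HK HS. destruct (classic (inhabited X)) as [[x0]|Hempty].
  (* On an empty [X] the map [f] is itself continuous; otherwise [f x0] serves as the base point in
     [Y]. *)
  2: { exists (fun _ => f). split.
       - intros _ V _. apply open_locally. intros x. destruct Hempty; constructor; exact x.
       - intros x. destruct Hempty; constructor; exact x. }
  destruct (choice _ (fun k => approximating_patches f (f x0) ((1/2) ^ k) HK HS (half_pow_pos k)))
    as [psi Hpsi].
  apply choice in Hpsi. destruct Hpsi as [l Hl].
  (* The approximation with index [N] runs through [N] levels and takes stage [N] of the patches at
     every level. *)
  assert (Hex : forall N, exists g : X -> Y, continuous g /\
     forall x j, (1 <= j <= N)%nat -> good f (fun k => psi k N) (fun k => l k N) j x ->
       d (g x) (f x) <= 6 * (1/2) ^ j).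
  { intros N. destruct (refinement f (fun k => psi k N) (fun k => l k N)
                (fun k => proj1 (Hl k) N) (fun k => proj1 (proj2 (Hl k)) N)
                (fun k => proj1 (proj2 (proj2 (Hl k))) N) (f x0) N)
      as [g [w [p [Hg [_ [_ [_ [_ [_ [_ Hb]]]]]]]]]].
    exists g. split; [exact Hg|]. intros x j Hj Hx. specialize (Hb x j Hj Hx).
    pose proof (half_pow_pos N). lra. }
  apply choice in Hex. destruct Hex as [fn Hfn]. exists fn.
  split; [intros n; apply Hfn|]. intros x.
  apply (converges_metric d d_metric d_topology). intros e He.
  destruct (pow_lt_1_zero (1/2)) with (e / 6) as [j Hj]; [rewrite Rabs_pos_eq; lra|lra|].
  (* [S j] ensures a level at least 1, as the bound of [refinement] requires. Only finitely many
     levels must be correct at [x], so a common stage exists. *)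
  specialize (Hj (S j) ltac:(lia)). rewrite Rabs_pos_eq in Hj by (left; apply half_pow_pos).
  destruct (eventually_forall_lt (fun k n => 1 <= psi k n x /\ l k n x (f x)) (S j)) as [N HN].
  { intros k _. apply (Hl k). }
  exists (Nat.max N (S j)). intros n Hn.
  eapply Rle_lt_trans; [apply (proj2 (Hfn n) x (S j)); [lia|]|lra].
  intros k Hk. apply HN; lia.
Qed.

End Approximation.

Theorem mainTheorem7 (X Y : TopSpace) :
  metrizable Y -> connected Y -> locally_arcwise_connected Y ->
  forall f : X -> Y, (K1 f /\ Sigma_f f) <-> Baire1 f.
Proof.
  intros [d [Hd Ht]] Hconn Hloc f. split.
  - intros [HK HS]. exact (K1_Sigma_f_Baire1 d Hd Ht Hconn Hloc f HK HS).
  - intros HB. split; [exact (Baire1_K1 d Hd Ht f HB)|exact (Baire1_Sigma_f d Hd Ht f HB)].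
Qed.
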